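(* Let $\Omega_1\subset\mathbb{R}^{d_1}$ and $\Omega_2\subset\mathbb{R}^{d_2}$ be compact domains, $\Omega=\Omega_1\times\Omega_2$, $c\in L^2(\Omega)$, $\gamma>0$, and let $\mu_i:\Omega_i\to\mathbb{R}$, $i=1,2$, be measurable functions. Consider the problem $$\min_{\pi\in L^2(\Omega)}\ \int_\Omega c\,\pi\,\mathrm{d}\lambda+\tfrac{\gamma}{2}\|\pi\|_{L^2(\Omega)}^2$$ subject to $$\int_{\Omega_2}\pi(x_1,x_2)\,\mathrm{d}\lambda_2=\mu_1(x_1),\qquad \int_{\Omega_1}\pi(x_1,x_2)\,\mathrm{d}\lambda_1=\mu_2(x_2),\qquad \pi(x_1,x_2)\ge 0,$$ where the constraints are understood pointwise almost everywhere. This problem has an optimal solution if and only if $\mu_1\in L^2(\Omega_1)$, $\mu_2\in L^2(\Omega_2)$, $\mu_1,\mu_2\ge 0$ almost everywhere, and $\int_{\Omega_1}\mu_1\,\mathrm{d}\lambda_1=\int_{\Omega_2}\mu_2\,\mathrm{d}\lambda_2$.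
   Context: $\lambda_1,\lambda_2,\lambda$ denote Lebesgue measure on $\Omega_1,\Omega_2,\Omega$ respectively. A compact domain is understood as a compact set of positive Lebesgue measure. An optimal solution is a feasible $\pi\in L^2(\Omega)$ attaining the minimum. *)

(* Defs.v *)
From HB Require Import structures.
From mathcomp Require Import all_boot all_order all_algebra.
From mathcomp Require Import all_classical all_reals all_analysis.
From mathcomp Require Import lra.

Set Implicit Arguments.
Unset Strict Implicit.
Unset Printing Implicit Defensive.

Import Order.TTheory GRing.Theory Num.Theory.
Import numFieldNormedType.Exports.

Local Open Scope classical_set_scope.
Local Open Scope ring_scope.

Section lebesgue_Rn.
Context {R : realType} {n : nat}.
Implicit Types (a b x : 'rV[R]_n) (X Y : set 'rV[R]_n).
Implicit Types B : option ('rV[R]_n * 'rV[R]_n).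

(* [Some (a, b)] is the half-open box of the x with a_i < x_i <= b_i for all i;
   [None] is the empty set. It is needed only for n = 0, where the box of
   [Some (a, b)] is never empty. *)
Definition box B : set 'rV[R]_n :=
  if B is Some (a, b) then [set x | forall i, a 0 i < x 0 i <= b 0 i]
  else set0.

Definition volume B : R :=
  if B is Some (a, b) then \prod_(i < n) Num.max 0 (b 0 i - a 0 i) else 0.

Definition lebesgue_outer X : \bar R :=
  ereal_inf [set (\sum_(k <oo) (volume (B k))%:E)%E |
    B in [set B : nat -> option ('rV[R]_n * 'rV[R]_n) |
           X `<=` \bigcup_k box (B k)]].

Local Open Scope ereal_scope.

Lemma volume_ge0 B : (0 <= volume B)%R.
Proof.
case: B => [[a b]|] //=; apply: prodr_ge0 => i _.
by rewrite le_max lexx.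
Qed.

Let evolume_ge0 B : 0 <= (volume B)%:E.
Proof. by rewrite lee_fin volume_ge0. Qed.

Lemma lebesgue_outer_ge0 X : 0 <= lebesgue_outer X.
Proof.
by apply: le_ereal_inf_tmp => _ [B _ <-]; apply: nneseries_ge0 => k _ _.
Qed.

Lemma lebesgue_outer0 : lebesgue_outer set0 = 0.
Proof.
apply/eqP; rewrite eq_le lebesgue_outer_ge0 andbT.
apply: ereal_inf_lbound; exists (fun=> None) => //=.
by rewrite eseries0.
Qed.

Lemma le_lebesgue_outer : {homo lebesgue_outer : X Y / X `<=` Y >-> X <= Y}.
Proof.
move=> X Y XY; apply/ereal_inf_le_tmp => _ [B YB <-].
by exists B => //; exact: subset_trans YB.
Qed.

Lemma lebesgue_outer_sigma_subadditive : sigma_subadditive lebesgue_outer.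
Proof.
move=> A; have [[i ioo]|] := pselect (exists i, lebesgue_outer (A i) = +oo).
  rewrite (eseries_pinfty _ _ ioo) ?leey// => m _.
  by rewrite -ltNye (lt_le_trans _ (lebesgue_outer_ge0 _)).
rewrite -forallNE => Aoo.
apply/lee_addgt0Pr => e e0.
rewrite (le_trans _ (epsilon_trick _ _ (ltW e0)))//; last first.
  by move=> m; exact: lebesgue_outer_ge0.
pose P m (B : nat -> option ('rV[R]_n * 'rV[R]_n)) :=
  A m `<=` \bigcup_k box (B k) /\
  \sum_(k <oo) (volume (B k))%:E
    <= lebesgue_outer (A m) + (e / (2 ^ m.+1)%:R)%:E.
have [G PG] : {G : nat -> nat -> option ('rV[R]_n * 'rV[R]_n) &
    forall m, P m (G m)}.
  apply: (@choice _ _ P) => m.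
  have em : (0 < e / (2 ^ m.+1)%:R :> R)%R by rewrite divr_gt0// ltr0n expn_gt0.
  have fin : lebesgue_outer (A m) \is a fin_num.
    rewrite ge0_fin_numE ?lebesgue_outer_ge0// ltey; exact/eqP/Aoo.
  have [_ [B AB <-] ltB] := lb_ereal_inf_adherent em fin.
  by exists B; split => //; exact: ltW.
pose v (z : nat * nat) : \bar R := (volume (G z.1 z.2))%:E.
have v0 z : 0 <= v z by exact: evolume_ge0.
apply: (@le_trans _ _ (\esum_(z in setT) v z)).
  have /card_esym/ppcard_eqP[f] := card_nat2.
  apply: ereal_inf_lbound; exists (fun k => G (f k).1 (f k).2).
    move=> x [i _] /(PG i).1 [j _ Gij]; exists (f^-1%FUN (i, j)) => //=.
    by rewrite invK ?inE.
  rewrite -[RHS](_ : \sum_(k <oo) v (f k) = _)//.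
  rewrite -(esum_pred_image v f xpredT) ?[fun=> _]set_true//.
  by rewrite image_eq.
rewrite (_ : esum _ _ = \sum_(i <oo) \sum_(j <oo) v (i, j)); last first.
  pose J i : set (nat * nat) := [set (i, j) | j in setT].
  rewrite (_ : setT = \bigcup_k J k); last first.
    by rewrite predeqE => -[i j]; split => // _; exists i => //; exists j.
  rewrite esum_bigcupT//=; last first.
    apply/trivIsetP => i j _ _ ij.
    rewrite predeqE => -[k l] /=; split => //= -[] [_] _ [<-{k} _].
    by move=> [? _] [] /esym/eqP; rewrite (negbTE ij).
  rewrite -(image_id [set: nat]) -fun_true esum_pred_image//; last first.
    by move=> k _; exact: esum_ge0.
  apply: eq_eseriesr => /= j _.
  rewrite -(esum_pred_image v (pair j) predT)//=; last first.
    by move=> ? ? _ _; exact: (@can_inj _ _ _ snd).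
  by congr esum; rewrite predeqE => -[k l]; split; move=> [i _ <-]; exists i.
apply: lee_nneseries => [i _ _|i _]; first by apply: nneseries_ge0.
exact: (PG i).2.
Qed.

HB.instance Definition _ := isOuterMeasure.Build R 'rV[R]_n lebesgue_outer
  lebesgue_outer0 lebesgue_outer_ge0 le_lebesgue_outer
  lebesgue_outer_sigma_subadditive.

End lebesgue_Rn.
Arguments lebesgue_outer : clear implicits.

(* The Caratheodory-measurable sets are the Lebesgue (not only the Borel)
   measurable sets. *)
Notation lebesgue_space R n := (caratheodory_type (lebesgue_outer R n)).

Definition lebesgue (R : realType) (n : nat) : set (lebesgue_space R n) -> \bar R :=
  lebesgue_outer R n.

Section lebesgue_measure_Rn.
Context {R : realType} {n : nat}.
Local Open Scope ereal_scope.

HB.instance Definition _ := isMeasure.Build _ _ _ (@lebesgue R n)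
  (@caratheodory_measure0 _ _ (lebesgue_outer R n))
  (@caratheodory_measure_ge0 _ _ (lebesgue_outer R n))
  (@caratheodory_measure_sigma_additive _ _ (lebesgue_outer R n)).

Let upd (a : 'rV[R]_n) i t : 'rV[R]_n := \row_j if j == i then t else a ord0 j.

Lemma measurable_halfspace (i : 'I_n) (t : R) :
  measurable ([set x : 'rV[R]_n | x ord0 i <= t]%R : set (lebesgue_space R n)).
Proof.
set H := [set x | _]; apply: le_caratheodory_measurable => X.
apply: le_ereal_inf_tmp => _ [B XB <-].
pose lo (C : option ('rV[R]_n * 'rV[R]_n)) :=
  omap (fun ab => (ab.1, upd ab.2 i (Num.min (ab.2 ord0 i) t))) C.
pose hi (C : option ('rV[R]_n * 'rV[R]_n)) :=
  omap (fun ab => (upd ab.1 i (Num.max (ab.1 ord0 i) t), ab.2)) C.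
have loE C : box C `&` H `<=` box (lo C).
  case: C => [[a b]|] //= x [] //= abx xt j; rewrite /upd mxE.
  case: eqP => [->|_]; last exact: abx.
  by have /andP[-> xb] := abx i; rewrite le_min xb.
have hiE C : box C `&` ~` H `<=` box (hi C).
  case: C => [[a b]|] //= x [] //= abx /negP; rewrite -ltNge => tx j.
  rewrite /upd mxE; case: eqP => [->|_]; last exact: abx.
  by have /andP[ax ->] := abx i; rewrite gt_max ax tx.
have vE C : volume C = (volume (lo C) + volume (hi C))%R.
  case: C => [[a b]|] /=; last by rewrite addr0.
  rewrite (bigD1 i)//= [X in (_ = X + _)%R](bigD1 i)//=.
  rewrite [X in (_ = _ + X)%R](bigD1 i)//= /upd !mxE eqxx.
  set P := (\prod_(_ < n | _) _)%R.
  rewrite [X in (_ = _ * X + _)%R](_ : _ = P); last first.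
    by apply: eq_bigr => j ji; rewrite mxE (negbTE ji).
  rewrite [X in (_ = _ + _ * X)%R](_ : _ = P); last first.
    by apply: eq_bigr => j ji; rewrite mxE (negbTE ji).
  rewrite -mulrDl; congr (_ * _)%R.
  move: (a ord0 i) (b ord0 i) => p q.
  have [?|?] := leP q t; have [?|?] := leP p t;
  rewrite /Num.max; repeat case: ifPn; rewrite -?leNgt => *; lra.
rewrite (_ : \sum_(k <oo) (volume (B k))%:E =
    \sum_(k <oo) (volume (lo (B k)))%:E + \sum_(k <oo) (volume (hi (B k)))%:E); last first.
  rewrite -nneseriesD; try by move=> k _ _; rewrite lee_fin volume_ge0.
  by apply: eq_eseriesr => k _; rewrite -EFinD -vE.
apply: leeD; apply: ereal_inf_lbound.
- exists (lo \o B) => // x [Xx Hx]; have [k _ Bx] := XB _ Xx.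
  by exists k => //; exact: loE.
- exists (hi \o B) => // x [Xx Hx]; have [k _ Bx] := XB _ Xx.
  by exists k => //; exact: hiE.
Qed.

Lemma measurable_box (B : option ('rV[R]_n * 'rV[R]_n)) :
  measurable (box B : set (lebesgue_space R n)).
Proof.
case: B => [[a b]|]; last exact: measurable0.
rewrite (_ : box _ = \bigcap_(i in [set: 'I_n])
    (~` [set x | x ord0 i <= a ord0 i] `&` [set x | x ord0 i <= b ord0 i])%R).
  apply: fin_bigcap_measurable => // i _; apply: measurableI;
    [apply: measurableC|]; exact: measurable_halfspace.
apply/seteqP; split => x /= abx i => [_|].
  by have /andP[ax xb] := abx i; split => //=; apply/negP; rewrite -ltNge.
by have [//|/negP] := abx i; rewrite -ltNge => -> ->.
Qed.

Let lebesgue_sigma_finite : sigma_finite setT (@lebesgue R n).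
Proof.
pose Q k : option ('rV[R]_n * 'rV[R]_n) :=
  Some (const_mx (- k%:R), const_mx k%:R)%R.
exists (fun k => box (Q k)); last first.
  move=> k; split; first exact: measurable_box.
  apply: (@le_lt_trans _ _ (volume (Q k))%:E); last exact: ltry.
  apply: ereal_inf_lbound; exists (fun j => if (j == 0)%N then Q k else None).
    by move=> x Qx; exists 0%N.
  rewrite nneseries_recl//; last by move=> j _; rewrite lee_fin volume_ge0.
  by rewrite eseries0 ?adde0// => -[].
apply/esym; rewrite -subTset => x _.
pose M : R := (\sum_(i < n) `|x ord0 i|)%R.
have M0 : (0 <= M)%R by exact: sumr_ge0.
exists (Num.truncn M).+1 => // i; rewrite !mxE.
have xM : (`|x ord0 i| < (Num.truncn M).+1%:R)%R.
  apply: (le_lt_trans _ (truncnS_gt M)).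
  by rewrite /M (bigD1 i)//= lerDl sumr_ge0.
by move: xM; rewrite ltr_norml => /andP[-> /ltW].
Qed.

HB.instance Definition _ := Measure_isSigmaFinite.Build _ _ _ (@lebesgue R n)
  lebesgue_sigma_finite.

End lebesgue_measure_Rn.
Arguments lebesgue : clear implicits.

Definition compact_domain (R : realType) (n : nat) (Om : set 'rV[R]_n) : Prop :=
  compact Om /\ (0 < lebesgue R n Om)%E.

(* Functions on a domain are represented by total functions whose values outside
   of the domain are irrelevant, and elements of L^2 by representatives. *)
Definition L2 (d : measure_display) (T : measurableType d) (R : realType)
    (mu : {measure set T -> \bar R}) (D : set T) (f : T -> R) : Prop :=
  f \_ D \in Lfun mu 2%:E.

Definition L2norm (d : measure_display) (T : measurableType d) (R : realType)
    (mu : {measure set T -> \bar R}) (D : set T) (f : T -> R) : R :=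
  fine ('N[mu]_2%:E[EFin \o f \_ D])%E.

Section problem.
Context (R : realType) (d1 d2 : nat).
Variables (Om1 : set 'rV[R]_d1) (Om2 : set 'rV[R]_d2).

(* On the product, Lebesgue measure is the product measure; as it is not
   completed, every L^2 class still has a measurable representative. *)
Local Notation l1 := (lebesgue R d1).
Local Notation l2 := (lebesgue R d2).
Local Notation l := (l1 \x l2)%E.

Definition objective (c : 'rV[R]_d1 * 'rV[R]_d2 -> R) (gamma : R)
    (p : 'rV[R]_d1 * 'rV[R]_d2 -> R) : R :=
  \int[l]_(z in Om1 `*` Om2) (c z * p z)
    + gamma / 2 * L2norm l (Om1 `*` Om2) p ^+ 2.

(* The marginals are extended-real integrals, so that the constraints include
   their finiteness. *)
Definition feasible (mu1 : 'rV[R]_d1 -> R) (mu2 : 'rV[R]_d2 -> R)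
    (p : 'rV[R]_d1 * 'rV[R]_d2 -> R) : Prop :=
  [/\ L2 l (Om1 `*` Om2) p,
      {ae l1, forall x1, Om1 x1 ->
        (\int[l2]_(x2 in Om2) (p (x1, x2))%:E = (mu1 x1)%:E)%E},
      {ae l2, forall x2, Om2 x2 ->
        (\int[l1]_(x1 in Om1) (p (x1, x2))%:E = (mu2 x2)%:E)%E} &
      {ae l, forall z, (Om1 `*` Om2) z -> 0 <= p z}].

Definition optimal (c : 'rV[R]_d1 * 'rV[R]_d2 -> R) (gamma : R)
    (mu1 : 'rV[R]_d1 -> R) (mu2 : 'rV[R]_d2 -> R)
    (p : 'rV[R]_d1 * 'rV[R]_d2 -> R) : Prop :=
  feasible mu1 mu2 p /\
  forall q, feasible mu1 mu2 q -> objective c gamma p <= objective c gamma q.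

End problem.

(* Main.v *)
(* Completing the square turns the objective, up to constants, into the squared
   L^2 distance to [- c / gamma]. An optimal solution is thus a projection of
   this point onto the set of square-integrable couplings of [mu1] and [mu2],
   which exists as soon as there is a coupling: the set is convex, and it is
   closed in L^2 since, on a domain of finite measure, L^2 convergence implies
   L^1 convergence and taking marginals is a contraction of L^1. The normalised
   product [mu1 * mu2 / mass] is a square-integrable coupling under the stated
   conditions on [mu1] and [mu2]. Conversely these hold for the marginals of any
   square-integrable coupling, by the Cauchy-Schwarz inequality and Fubini's
   theorem. *)

Require Import Defs.
From HB Require Import structures.
From mathcomp Require Import all_boot all_order all_algebra.
From mathcomp Require Import all_classical all_reals all_analysis.
From mathcomp Require Import measurable_realfun lra ring.

Set Implicit Arguments.
Unset Strict Implicit.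
Unset Printing Implicit Defensive.

Import Order.TTheory GRing.Theory Num.Theory.
Import numFieldNormedType.Exports.

Local Open Scope classical_set_scope.
Local Open Scope ring_scope.

Section compact_lebesgue.
Context (R : realType) (n : nat).
Implicit Types (x y : 'rV[R]_n) (e : R) (K : set 'rV[R]_n).

Let cube x e := box (Some (x - const_mx e, x + const_mx e)).

Let cubeP x e y : cube x e y <-> forall i, x 0 i - e < y 0 i <= x 0 i + e.
Proof. by split => H i; have := H i; rewrite !mxE. Qed.

Let nbhs_cube x e : 0 < e -> nbhs x (cube x e).
Proof.
move=> e0; apply/nbhs_ballP; exists e => //= y [_ xy]; apply/cubeP => i.
have := xy 0 i; rewrite /ball/= ltr_norml => /andP[? ?].
by apply/andP; split; lra.
Qed.

Lemma compact_cube_cover K e : compact K -> 0 < e ->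
  exists s : seq 'rV[R]_n, (forall x, x \in s -> K x) /\
    K `<=` \bigcup_(x in [set` s]) cube x e.
Proof.
move=> + e0; rewrite compact_cover => /(_ _ K (fun x => (cube x e)°)) [].
- by move=> i _; exact: open_interior.
- by move=> x Kx; exists x => //; exact: nbhs_cube.
move=> D DK KD; exists (finmap.enum_fset D); split.
  by move=> x xD; have := DK x xD; rewrite inE.
by move=> x /KD[y yD xy]; exists y => //; exact: interior_subset xy.
Qed.

Lemma compact_lebesgue_measurable K : compact K ->
  measurable (K : set (lebesgue_space R n)).
Proof.
move=> cK; have inv_gt0 k : 0 < k.+1%:R^-1 :> R by rewrite invr_gt0 ltr0Sn.
have [s sK] := choice (fun k => compact_cube_cover cK (inv_gt0 k)).
suff -> : K = \bigcap_k \bigcup_(x in [set` s k]) cube x k.+1%:R^-1.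
  apply: bigcap_measurable => // k _.
  by apply: fin_bigcup_measurable => // x _; exact: measurable_box.
apply/seteqP; split => [x Kx k _|x sx]; first exact: (sK k).2.
have /closure_id -> : closed K.
  by apply: compact_closed => //; exact: norm_hausdorff.
move=> B /nbhs_ballP[e /= e0 eB].
have [k ke] : exists k, k.+1%:R^-1 < e.
  exists (Num.truncn e^-1); rewrite invf_plt ?posrE//.
  exact: truncnS_gt.
have [y ys /cubeP yx] := sx k I; exists y; split; first exact: (sK k).1.
apply: eB; split => // i j; rewrite ord1 /ball/= ltr_norml.
by move: ke (yx j); move: (_^-1) => r ? /andP[? ?]; apply/andP; split; lra.
Qed.

Lemma lebesgue_box_le B : (lebesgue R n (box B) <= (volume B)%:E)%E.
Proof.
apply: ereal_inf_lbound; exists (fun j => if (j == 0)%N then B else None).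
  by move=> x Bx; exists 0%N.
rewrite nneseries_recl//; last by move=> j _; rewrite lee_fin volume_ge0.
by rewrite eseries0 ?adde0// => -[].
Qed.

Lemma compact_lebesgue_lty K : compact K -> (lebesgue R n K < +oo)%E.
Proof.
move=> cK; have [s [_ Ks]] := compact_cube_cover cK ltr01.
apply: (le_lt_trans (le_lebesgue_outer Ks)).
rewrite bigcup_seq; elim: s {Ks} => [|x s IHs].
  by rewrite big_nil lebesgue_outer0.
rewrite big_cons (le_lt_trans (outer_measureU2 _ _ _))// lte_add_pinfty//.
exact: le_lt_trans (lebesgue_box_le _) (ltry _).
Qed.

End compact_lebesgue.

Section powR_norm.
Context (R : realType).

Lemma continuous_norm_powR (p : R) : 0 < p ->
  continuous (fun x : R => `|x| `^ p).
Proof.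
move=> p0 x; rewrite /continuous_at; have [->|x0] := eqVneq x 0.
  rewrite normr0 powR0 ?gt_eqF//.
  apply/(cvgr0Pnorm_lt (F := nbhs (0 : R))) => e e0.
  near=> y; rewrite ger0_norm ?powR_ge0//.
  rewrite -[ltRHS](powRr1 (ltW e0)) -(mulVf (lt0r_neq0 p0)) powRrM.
  rewrite gt0_ltr_powR ?nnegrE ?powR_ge0//.
  by near: y; apply: (@nbhs0_lt _ R^o); exact: powR_gt0.
have expE (y : R) : y != 0 -> `|y| `^ p = expR (p * ln `|y|).
  by move=> y0; rewrite /powR normr_eq0 (negbTE y0).
have nearE : \forall y \near x, expR (p * ln `|y|) = `|y| `^ p.
  have : \forall y \near x, y != 0.
    by apply: open_nbhs_nbhs; split => //; exact: open_neq.
  by apply: filterS => y /expE.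
rewrite expE//; apply: cvg_trans (near_eq_cvg nearE) _.
apply: (cvg_comp (fun y => p * ln `|y|)); last exact: continuous_expR.
apply: cvgMr; apply: (cvg_comp (fun y : R => `|y|)).
  exact: (@norm_continuous _ R^o).
by apply: continuous_ln; rewrite normr_gt0.
Unshelve. all: by end_near. Qed.

Lemma lee_poweR (r : R) (x y : \bar R) : 0 <= r -> (0 <= x)%E -> (x <= y)%E ->
  (x `^ r <= y `^ r)%E.
Proof.
move=> r0 x0 xy; apply: gt0_ler_poweR; rewrite ?in_itv/= ?leey ?andbT//.
exact: le_trans xy.
Qed.

End powR_norm.

Section Lfun_algebra.
Context (d : measure_display) (T : measurableType d) (R : realType).
Variables (mu : {measure set T -> \bar R}) (p : \bar R).
Hypothesis p1 : (1 <= p)%E.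
Implicit Types f g h : T -> R.
Local Notation "''N_' p [ f ]" := ('N[mu]_p[EFin \o f%R])%E.

Lemma Lfun_measurable f : f \in Lfun mu p -> measurable_fun setT f.
Proof. by move=> /sub_Lfun_mfun; rewrite inE. Qed.

Lemma Lfun_LnormP f :
  f \in Lfun mu p <-> measurable_fun setT f /\ ('N_p[f] < +oo)%E.
Proof.
rewrite inE; split=> [/andP[/[!inE]]//|[mf finf]].
by apply/andP; rewrite !inE.
Qed.

Lemma LfunD f g : f \in Lfun mu p -> g \in Lfun mu p -> f \+ g \in Lfun mu p.
Proof. exact: (Lfun_addr_closed mu p1).2. Qed.

Lemma LfunZ k f : f \in Lfun mu p -> k \*: f \in Lfun mu p.
Proof.
move=> Lf; have [L0 Llin] := Lfun_submod_closed mu p1.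
by have := Llin k f 0 Lf L0; rewrite addr0.
Qed.

Lemma LfunB f g : f \in Lfun mu p -> g \in Lfun mu p -> f \- g \in Lfun mu p.
Proof. by move=> Lf Lg; rewrite LfunD// Lfun_oppr_closed. Qed.

Lemma Lnorm_distC f g : 'N_p[f \- g] = 'N_p[g \- f].
Proof.
rewrite -oppe_Lnorm; congr Lnorm.
by apply/funext => x /=; rewrite opprB.
Qed.

Lemma Lnorm_triangle f g h :
  f \in Lfun mu p -> g \in Lfun mu p -> h \in Lfun mu p ->
  ('N_p[f \- h] <= 'N_p[f \- g] + 'N_p[g \- h])%E.
Proof.
move=> /Lfun_measurable mf /Lfun_measurable mg /Lfun_measurable mh.
have -> : f \- h = (f \- g) \+ (g \- h).
  by apply/funext => x /=; rewrite addrA subrK.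
by apply: eminkowski => //; exact: measurable_funB.
Qed.

Lemma le_Lnorm_sum (I : Type) (s : seq I) (u : I -> T -> R) :
  (forall i, measurable_fun setT (u i)) ->
  ('N_p[(fun x => \sum_(i <- s) u i x)] <= \sum_(i <- s) 'N_p[u i])%E.
Proof.
move=> meas_u; elim: s => [|i s IHs].
  under [X in Lnorm _ _ (_ \o X)]eq_fun do rewrite big_nil.
  by rewrite big_nil Lnorm0// gt_eqF// (lt_le_trans lte01).
under [X in Lnorm _ _ (_ \o X)]eq_fun do rewrite big_cons.
rewrite big_cons (le_trans (eminkowski _ _ _ p1))//.
  exact: measurable_sum.
by rewrite leeD2l.
Qed.

End Lfun_algebra.

Section Lnorm_powR.
Context (d : measure_display) (T : measurableType d) (R : realType).
Variables (mu : {measure set T -> \bar R}) (p : R).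
Hypothesis p1 : 1 <= p.
Implicit Types (f g v : T -> R) (u : nat -> T -> R).
Local Notation "''N_' p [ f ]" := ('N[mu]_p[EFin \o f%R])%E.

Let p_gt0 : 0 < p. Proof. exact: lt_le_trans p1. Qed.
Let p_neq0 : p != 0. Proof. by rewrite gt_eqF. Qed.
Let p1E : (1 <= p%:E)%E. Proof. by rewrite lee_fin. Qed.

Lemma measurable_norm_powR f : measurable_fun setT f ->
  measurable_fun setT (fun x => (`|f x| `^ p)%:E).
Proof.
move=> mf; apply/measurable_EFinP.
by apply: (measurableT_comp (measurable_powR p)); exact: measurableT_comp.
Qed.

Lemma Lnorm_powRE f : ('N_p%:E[f] `^ p = \int[mu]_x (`|f x| `^ p)%:E)%E.
Proof. by rewrite poweR_Lnorm. Qed.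

Lemma Lnorm_le_integralP f (C : \bar R) : (0 <= C)%E ->
  ('N_p%:E[f] <= C)%E <-> (\int[mu]_x (`|f x| `^ p)%:E <= C `^ p)%E.
Proof.
have powK x : (0 <= x)%E -> ((x `^ p) `^ p^-1 = x)%E.
  by move=> x0; rewrite -poweRrM mulfV// poweRe1.
move=> C0; rewrite -Lnorm_powRE; split=> [|NC].
  by apply: lee_poweR; rewrite ?Lnorm_ge0// ltW.
rewrite -(powK _ C0) -(powK 'N_p%:E[f])%E ?Lnorm_ge0//.
by apply: lee_poweR; rewrite ?poweR_ge0// invr_ge0 ltW.
Qed.

Lemma Lfun_integralP f : f \in Lfun mu p%:E <->
  measurable_fun setT f /\ (\int[mu]_x (`|f x| `^ p)%:E < +oo)%E.
Proof.
rewrite -Lnorm_powRE; split=> [/Lfun_LnormP[mf finf]|[mf finf]].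
  by split=> //; exact: poweR_lty.
by apply/Lfun_LnormP; split=> //; exact: lty_poweRy finf.
Qed.

Lemma le_Lnorm f g : measurable_fun setT f -> measurable_fun setT g ->
  (forall x, `|f x| <= `|g x|) -> ('N_p%:E[f] <= 'N_p%:E[g])%E.
Proof.
move=> mf mg fg; apply/(Lnorm_le_integralP _ (Lnorm_ge0 _ _ _)).
rewrite Lnorm_powRE; apply: ge0_le_integral => //.
- exact: measurable_norm_powR.
- exact: measurable_norm_powR.
- by move=> x _; rewrite lee_fin ge0_ler_powR ?nnegrE// ltW.
Qed.

Lemma le_Lfun f g : measurable_fun setT f -> (forall x, `|f x| <= `|g x|) ->
  g \in Lfun mu p%:E -> f \in Lfun mu p%:E.
Proof.
move=> mf fg /Lfun_LnormP[mg fing]; apply/Lfun_LnormP; split=> //.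
exact: le_lt_trans (le_Lnorm mf mg fg) fing.
Qed.

Lemma Lfun_comp_norm f :
  f \in Lfun mu p%:E -> Num.norm \o f \in Lfun mu p%:E.
Proof.
move=> /[dup] Lf /Lfun_measurable mf; apply: le_Lfun Lf => [|x].
  exact: measurableT_comp.
by rewrite /= normr_id.
Qed.

Lemma ae_eq_Lnorm f g : measurable_fun setT f -> measurable_fun setT g ->
  f = g %[ae mu] -> ('N_p%:E[f] = 'N_p%:E[g])%E.
Proof.
move=> mf mg fg; rewrite unlock; congr (_ `^ _)%E; apply: ae_eq_integral => //.
- exact: measurable_norm_powR.
- exact: measurable_norm_powR.
- by apply: filterS fg => x /(_ I) /= ->.
Qed.

Lemma ae_eq_Lfun f g : measurable_fun setT g -> f = g %[ae mu] ->
  f \in Lfun mu p%:E -> g \in Lfun mu p%:E.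
Proof.
move=> mg fg /Lfun_LnormP[mf finf]; apply/Lfun_LnormP.
by rewrite -(ae_eq_Lnorm mf mg fg).
Qed.

Lemma Lnorm_eq0P f : measurable_fun setT f ->
  'N_p%:E[f] = 0%E <-> f = cst 0 %[ae mu].
Proof.
move=> mf; split=> [|f0]; last first.
  by rewrite (ae_eq_Lnorm mf _ f0)// Lnorm0.
move=> /Lnorm_eq0_eq0 f0.
have /f0 : measurable_fun setT (EFin \o f) by exact/measurable_EFinP.
by rewrite lte_fin => /(_ p_gt0); apply: filterS => x /[apply] -[].
Qed.

Lemma LnormB_eq0P f g : f \in Lfun mu p%:E -> g \in Lfun mu p%:E ->
  'N_p%:E[f \- g] = 0%E <-> f = g %[ae mu].
Proof.
move=> Lf Lg; rewrite (Lnorm_eq0P (Lfun_measurable (LfunB p1E Lf Lg))).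
split; apply: filterS => x /[apply] /=; last by move=> ->; rewrite subrr.
by move=> /eqP; rewrite subr_eq0 => /eqP.
Qed.

Lemma Lnorm_cvg_unique u v w : (forall n, u n \in Lfun mu p%:E) ->
  v \in Lfun mu p%:E -> w \in Lfun mu p%:E ->
  ('N_p%:E[u n \- v] @[n --> \oo] --> 0)%E ->
  ('N_p%:E[u n \- w] @[n --> \oo] --> 0)%E -> v = w %[ae mu].
Proof.
move=> Lu Lv Lw uv uw.
apply/(LnormB_eq0P Lv Lw)/eqP; rewrite eq_le Lnorm_ge0 andbT.
have /cvge_to_ge :
    ('N_p%:E[u n \- v] + 'N_p%:E[u n \- w] @[n --> \oo] --> 0 + 0)%E.
  exact: cvgeD.
rewrite adde0; apply; apply: nearW => n.
by rewrite (Lnorm_distC _ _ (u n)) Lnorm_triangle.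
Qed.

Lemma ae_eq_Lnorm_lim u v g : (forall n, u n \in Lfun mu p%:E) ->
  v \in Lfun mu p%:E -> (forall n, u n = g %[ae mu]) ->
  ('N_p%:E[u n \- v] @[n --> \oo] --> 0)%E -> v = g %[ae mu].
Proof.
move=> Lu Lv ug uv; apply: ae_eq_trans (ug 0%N).
apply: (Lnorm_cvg_unique Lu Lv (Lu 0%N) uv).
rewrite [X in X @ _ --> _](_ : _ = cst 0%E); first exact: cvg_cst.
apply/funext => n; apply/(LnormB_eq0P (Lu n) (Lu 0%N)).
exact: ae_eq_trans (ug n) (ae_eq_sym (ug 0%N)).
Qed.

Lemma ae_ge0P f : {ae mu, forall x, 0 <= f x} <-> f = Num.norm \o f %[ae mu].
Proof.
split; apply: filterS => x; first by move=> fx _; rewrite /= ger0_norm.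
by move=> /(_ I) ->; exact: normr_ge0.
Qed.

Lemma ae_ge0_Lnorm_lim u v : (forall n, u n \in Lfun mu p%:E) ->
  v \in Lfun mu p%:E -> (forall n, {ae mu, forall x, 0 <= u n x}) ->
  ('N_p%:E[u n \- v] @[n --> \oo] --> 0)%E -> {ae mu, forall x, 0 <= v x}.
Proof.
move=> Lu Lv u0 uv; apply/ae_ge0P.
apply: (Lnorm_cvg_unique Lu Lv (Lfun_comp_norm Lv) uv).
apply: (squeeze_cvge _ (cvg_cst 0%E) uv); apply: nearW => n.
have mB f g (Lf : f \in Lfun mu p%:E) (Lg : g \in Lfun mu p%:E) :=
  Lfun_measurable (LfunB p1E Lf Lg).
rewrite Lnorm_ge0/= (@ae_eq_Lnorm _ ((Num.norm \o u n) \- (Num.norm \o v))).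
- apply: le_Lnorm => [||x]; last exact: ler_dist_dist.
    exact: mB (Lfun_comp_norm _) (Lfun_comp_norm _).
  exact: mB.
- exact: mB (Lfun_comp_norm _).
- exact: mB (Lfun_comp_norm _) (Lfun_comp_norm _).
- by have /ae_ge0P := u0 n; apply: filterS => x /[apply] /= <-.
Qed.

Lemma Lnorm_le_cvg u v (C : \bar R) : (forall n, measurable_fun setT (u n)) ->
  measurable_fun setT v -> {ae mu, forall x, u ^~ x @ \oo --> v x} ->
  (forall n, ('N_p%:E[u n] <= C)%E) -> ('N_p%:E[v] <= C)%E.
Proof.
move=> meas_u mv uv uC.
have C0 : (0 <= C)%E := le_trans (Lnorm_ge0 _ _ _) (uC 0%N).
have m_powu n := measurable_norm_powR (meas_u n).
have pow_ge0 n x : setT x -> (0 <= (`|u n x| `^ p)%:E)%E.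
  by rewrite lee_fin powR_ge0.
apply/(Lnorm_le_integralP _ C0).
rewrite (ae_eq_integral (fun x => limn_einf (fun n => (`|u n x| `^ p)%:E)))//.
- apply: (le_trans (fatou mu measurableT m_powu pow_ge0)).
  rewrite limn_einf_lim; apply: lime_le; first exact: is_cvg_einfs.
  apply: nearW => n; apply: (@le_trans _ _ (\int[mu]_x (`|u n x| `^ p)%:E)%E).
    by apply: ereal_inf_lbound; exists n => /=.
  exact/(Lnorm_le_integralP _ C0).
- exact: measurable_norm_powR.
- apply: measurableT_comp => //; apply: measurable_fun_limn_esup => n.
  exact: measurableT_comp.
- apply: filterS uv => x uvx _; apply/esym.
  rewrite (cvg_limn_einf_sup (l := (`|v x| `^ p)%:E))//.
  apply: cvg_EFin; first exact: nearW.
  apply: (cvg_comp (u ^~ x) (fun y => `|y| `^ p) uvx).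
  exact: continuous_norm_powR.
Qed.

End Lnorm_powR.

Section Lfun_complete.
Context (d : measure_display) (T : measurableType d) (R : realType).
Variables (mu : {measure set T -> \bar R}) (p : R) (u : nat -> T -> R).
Hypothesis p1 : 1 <= p.
Hypothesis Lu : forall n, u n \in Lfun mu p%:E.
Local Notation "''N_' p [ f ]" := ('N[mu]_p[EFin \o f%R])%E.
Hypothesis summable_u : (\sum_(n <oo) 'N_p%:E[u n.+1 \- u n] < +oo)%E.

Let p_gt0 : 0 < p. Proof. exact: lt_le_trans p1. Qed.
Let p1E : (1 <= p%:E)%E. Proof. by rewrite lee_fin. Qed.

Let measurable_u n : measurable_fun setT (u n).
Proof. exact: Lfun_measurable (Lu n). Qed.

Let Lnorm_incr_ge0 n : (0 <= 'N_p%:E[u n.+1 \- u n])%E.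
Proof. exact: Lnorm_ge0. Qed.

Lemma Lnorm_dist_le_tail n k :
  ('N_p%:E[u (k + n)%N \- u n] <= \sum_(n <= i <oo) 'N_p%:E[u i.+1 \- u i])%E.
Proof.
have -> : u (k + n)%N \- u n = fun x => \sum_(n <= i < k + n) (u i.+1 \- u i) x.
  by apply/funext => x /=; rewrite (telescope_sumr (u ^~ x)) ?leq_addl.
apply: (le_trans (le_Lnorm_sum _ p1E _ _)).
  by move=> i; exact: measurable_funB.
exact: nneseries_lim_ge.
Qed.

Let variation x n : R := \sum_(0 <= i < n) `|u i.+1 x - u i x|.

Let nondecreasing_variation x : nondecreasing_seq (variation x).
Proof. by apply: nondecreasing_series => i _ _; exact: normr_ge0. Qed.

Let norm_variation x n : `|variation x n| = variation x n.
Proof. by rewrite ger0_norm// sumr_ge0. Qed.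

Let nondecreasing_powR_variation x :
  nondecreasing_seq (fun n => (`|variation x n| `^ p)%:E).
Proof.
move=> m n mn; rewrite lee_fin !norm_variation ge0_ler_powR ?nnegrE ?sumr_ge0//.
  exact: ltW.
exact: nondecreasing_variation.
Qed.

Let measurable_variation n : measurable_fun setT (variation ^~ n).
Proof.
apply: measurable_sum => i.
by apply: measurableT_comp => //; exact: measurable_funB.
Qed.

Let powR_variation_ge0 n x : (0 <= (`|variation x n| `^ p)%:E)%E.
Proof. by rewrite lee_fin powR_ge0. Qed.

Let sup_powR_variation x := limn (fun n => (`|variation x n| `^ p)%:E).

Let powR_variation_le_sup x n :
  ((`|variation x n| `^ p)%:E <= sup_powR_variation x)%E.
Proof.
rewrite /sup_powR_variation.
have := ereal_nondecreasing_cvgn (@nondecreasing_powR_variation x).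
move=> /cvg_lim -> //.
by apply: ereal_sup_ubound; exists n.
Qed.

Let Lnorm_variation_le n :
  ('N_p%:E[variation ^~ n] <= \sum_(i <oo) 'N_p%:E[u i.+1 \- u i])%E.
Proof.
apply: (le_trans (le_Lnorm_sum _ p1E _ _)) => [i|].
  by apply: measurableT_comp => //; exact: measurable_funB.
apply: le_trans (nneseries_lim_ge n (fun i _ _ => Lnorm_incr_ge0 i)).
by apply: lee_sum => i _; rewrite -[leRHS]Lnorm_abse.
Qed.

Let integrable_sup_powR_variation : mu.-integrable setT sup_powR_variation.
Proof.
have sup_ge0 x : (0 <= sup_powR_variation x)%E.
  exact: le_trans (powR_variation_ge0 0 x) (powR_variation_le_sup x 0).
apply/integrableP; split.
  apply: (emeasurable_fun_cvg (fun n x => (`|variation x n| `^ p)%:E)).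
    by move=> n; exact: measurable_norm_powR.
  by move=> x _; exact: ereal_nondecreasing_is_cvgn.
under eq_integral do rewrite gee0_abs//.
rewrite monotone_convergence//; last by move=> n; exact: measurable_norm_powR.
apply: le_lt_trans (poweR_lty p summable_u).
apply: lime_le => //.
  apply: ereal_nondecreasing_is_cvgn => m n mn; apply: ge0_le_integral => //.
  - exact: measurable_norm_powR.
  - exact: measurable_norm_powR.
  - by move=> x _; exact: nondecreasing_powR_variation.
apply: nearW => n; apply/(Lnorm_le_integralP _ p1); first exact: nneseries_ge0.
exact: Lnorm_variation_le.
Qed.

Lemma ae_cvg_summable_increments : {ae mu, forall x, cvgn (u ^~ x)}.
Proof.
apply: filterS (integrable_ae measurableT integrable_sup_powR_variation).
move=> x /(_ I) sup_fin.
have -> : u ^~ x = fun n => u 0%N x + series (fun i => u i.+1 x - u i x) n.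
  by apply/funext => n; rewrite /series/= (telescope_sumr (u ^~ x))// subrKC.
apply: is_cvgD; first exact: is_cvg_cst.
apply: (@normed_cvg _ R^o); apply: nondecreasing_is_cvgn.
  exact: nondecreasing_variation.
exists (fine (sup_powR_variation x) `^ p^-1) => _ [n _ <-].
rewrite -[leLHS](norm_variation x n) -[leLHS]powRr1//.
rewrite -(mulfV (lt0r_neq0 p_gt0)) powRrM -lee_fin -!poweR_EFin fineK//.
apply: lee_poweR (powR_variation_le_sup x n); last exact: powR_variation_ge0.
by rewrite invr_ge0 ltW.
Qed.

(* The Riesz-Fischer theorem: summability of the increments is no restriction,
   as every Cauchy sequence has such a subsequence. *)
Theorem Lfun_complete : exists2 v, v \in Lfun mu p%:E &
  ('N_p%:E[u n \- v] @[n --> \oo] --> 0)%E.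
Proof.
pose v x := fine (limn_esup (fun n => (u n x)%:E)).
have mv : measurable_fun setT v.
  apply: measurableT_comp => //; apply: measurable_fun_limn_esup => n.
  exact/measurable_EFinP.
have uv : {ae mu, forall x, u ^~ x @ \oo --> v x}.
  apply: filterS ae_cvg_summable_increments => x ux.
  have /cvg_limn_einf_sup[_ lim_u] :
      (EFin \o u ^~ x) @ \oo --> (limn (u ^~ x))%:E.
    by apply: cvg_EFin => //; exact: nearW.
  by rewrite /v lim_u.
have dist_v n :
    ('N_p%:E[v \- u n] <= \sum_(n <= i <oo) 'N_p%:E[u i.+1 \- u i])%E.
  apply: (Lnorm_le_cvg p1 (u := fun k => u (k + n)%N \- u n)).
  - by move=> k; exact: measurable_funB.
  - exact: measurable_funB.
  - apply: filterS uv => x uvx; apply: cvgB; last exact: cvg_cst.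
    by rewrite -(cvg_shiftn n) in uvx.
  - exact: Lnorm_dist_le_tail.
have Lvu : v \- u 0%N \in Lfun mu p%:E.
  apply/Lfun_LnormP; split; first exact: measurable_funB.
  exact: le_lt_trans (dist_v 0%N) summable_u.
exists v.
  rewrite (_ : v = (v \- u 0%N) \+ u 0%N); first exact: LfunD.
  by apply/funext => x /=; rewrite subrK.
apply: (squeeze_cvge _ (cvg_cst 0%E)); last first.
  exact: nneseries_tail_cvg summable_u (fun i _ => Lnorm_incr_ge0 i).
by apply: nearW => n; rewrite Lnorm_ge0/= Lnorm_distC.
Qed.

End Lfun_complete.

Section Lfun2.
Context (d : measure_display) (T : measurableType d) (R : realType).
Variable mu : {measure set T -> \bar R}.
Implicit Types f g h : T -> R.

Definition Lnorm2 f : R := fine 'N[mu]_2%:E[EFin \o f].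

Lemma Lnorm2_ge0 f : 0 <= Lnorm2 f.
Proof. by rewrite fine_ge0 ?Lnorm_ge0. Qed.

Lemma EFin_Lnorm2 f : f \in Lfun mu 2%:E ->
  (Lnorm2 f)%:E = ('N[mu]_2%:E[EFin \o f])%E.
Proof.
by move=> /Lfun_LnormP[_ finf]; rewrite fineK// ge0_fin_numE ?Lnorm_ge0.
Qed.

Lemma Lnorm2_triangle f g h :
  f \in Lfun mu 2%:E -> g \in Lfun mu 2%:E -> h \in Lfun mu 2%:E ->
  Lnorm2 (f \- h) <= Lnorm2 (f \- g) + Lnorm2 (g \- h).
Proof.
move=> Lf Lg Lh; rewrite -lee_fin EFinD !EFin_Lnorm2 ?LfunB ?lee1n//.
by apply: Lnorm_triangle => //; rewrite lee1n.
Qed.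

Lemma sqr_Lnorm2 f : f \in Lfun mu 2%:E ->
  Lnorm2 f ^+ 2 = \int[mu]_x (f x ^+ 2).
Proof.
move=> Lf; rewrite -powR_mulrn ?Lnorm2_ge0// -fine_poweR poweR_Lnorm//.
congr fine; apply: eq_integral => x _ /=.
by rewrite powR_mulrn// -normrX ger0_norm ?sqr_ge0.
Qed.

Lemma integrableZ_sqr k f : f \in Lfun mu 2%:E ->
  mu.-integrable setT (EFin \o (fun x => k * f x ^+ 2)).
Proof.
by move=> /Lfun2_integrable_sqr; exact: (integrableZl measurableT k).
Qed.

Lemma Lnorm2_parallelogram f g h :
  f \in Lfun mu 2%:E -> g \in Lfun mu 2%:E -> h \in Lfun mu 2%:E ->
  Lnorm2 (f \- g) ^+ 2 = 2 * Lnorm2 (f \- h) ^+ 2 + 2 * Lnorm2 (g \- h) ^+ 2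
    - 4 * Lnorm2 (2^-1 \*: (f \+ g) \- h) ^+ 2.
Proof.
move=> Lf Lg Lh; have p1 := lee1n 2 : (1 <= 2%:E :> \bar R)%E.
have Lmid : 2^-1 \*: (f \+ g) \in Lfun mu 2%:E by exact/LfunZ/LfunD.
have [Lfg Lfh] := (LfunB p1 Lf Lg, LfunB p1 Lf Lh).
have [Lgh Lmidh] := (LfunB p1 Lg Lh, LfunB p1 Lmid Lh).
rewrite !sqr_Lnorm2// -!RintegralZl ?Lfun2_integrable_sqr//.
have i_sum :=
  integrableD measurableT (integrableZ_sqr 2 Lfh) (integrableZ_sqr 2 Lgh).
rewrite -RintegralD ?integrableZ_sqr// -RintegralB ?integrableZ_sqr//.
by apply: eq_Rintegral => x _ /=; rewrite /GRing.scale/=; field.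
Qed.

Lemma complete_square (c p : T -> R) (gamma : R) : gamma != 0 ->
  c \in Lfun mu 2%:E -> p \in Lfun mu 2%:E ->
  \int[mu]_x (c x * p x) + gamma / 2 * Lnorm2 p ^+ 2 =
  gamma / 2 * Lnorm2 (p \- (- gamma^-1 \*: c)) ^+ 2
    - gamma / 2 * Lnorm2 (- gamma^-1 \*: c) ^+ 2.
Proof.
move=> gamma0 Lc Lp; have p1 := lee1n 2 : (1 <= 2%:E :> \bar R)%E.
have Lcz : - gamma^-1 \*: c \in Lfun mu 2%:E by exact: LfunZ.
have Lpc := LfunB p1 Lp Lcz.
have icp : mu.-integrable setT (EFin \o (fun x => c x * p x)).
  exact/Lfun1_integrable/Lfun2_mul_Lfun1.
rewrite !sqr_Lnorm2// -!RintegralZl ?Lfun2_integrable_sqr//.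
rewrite -RintegralD ?integrableZ_sqr// -RintegralB ?integrableZ_sqr//.
by apply: eq_Rintegral => x _ /=; rewrite /GRing.scale/=; field.
Qed.

End Lfun2.

Definition Lnorm_closed (d : measure_display) (T : measurableType d)
    (R : realType) (mu : {measure set T -> \bar R}) (p : \bar R)
    (K : set (T -> R)) : Prop :=
  forall (u : nat -> T -> R) (v : T -> R), (forall n, K (u n)) ->
    v \in Lfun mu p -> ('N[mu]_p[EFin \o (u n \- v)%R] @[n --> \oo] --> 0)%E ->
    K v.

Definition midpoint_closed (T : Type) (R : realType) (K : set (T -> R)) :
    Prop :=
  forall f g, K f -> K g -> K (2^-1 \*: (f \+ g)).

Section Lfun2_projection.
Context (d : measure_display) (T : measurableType d) (R : realType).
Variables (mu : {measure set T -> \bar R}) (K : set (T -> R)) (f : T -> R).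
Hypotheses (K0 : K !=set0) (KL : forall p, K p -> p \in Lfun mu 2%:E).
Hypotheses (K_mid : midpoint_closed K) (K_closed : Lnorm_closed mu 2%:E K).
Hypothesis Lf : f \in Lfun mu 2%:E.
Implicit Types p q : T -> R.

Let dist2 := inf [set Lnorm2 mu (p \- f) ^+ 2 | p in K].

Let has_inf_dist2 : has_inf [set Lnorm2 mu (p \- f) ^+ 2 | p in K].
Proof.
have [p Kp] := K0; split; first by exists (Lnorm2 mu (p \- f) ^+ 2), p.
by exists 0 => _ [q _ <-]; exact: sqr_ge0.
Qed.

Let dist2_le p : K p -> dist2 <= Lnorm2 mu (p \- f) ^+ 2.
Proof. by move=> Kp; apply: ge_inf; [exact: has_inf_dist2.2|exists p]. Qed.

Lemma dist_almost_minimizers_le p q (e : R) : 0 <= e -> K p -> K q ->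
  Lnorm2 mu (p \- f) ^+ 2 <= dist2 + e ^+ 2 ->
  Lnorm2 mu (q \- f) ^+ 2 <= dist2 + e ^+ 2 -> Lnorm2 mu (p \- q) <= 2 * e.
Proof.
move=> e0 Kp Kq pe qe; have mid_ge := dist2_le (K_mid Kp Kq).
have := Lnorm2_parallelogram (KL Kp) (KL Kq) Lf => par.
rewrite -(@ler_pXn2r _ 2) ?nnegrE ?Lnorm2_ge0 ?mulr_ge0// par exprMn; lra.
Qed.

Let tol n : R := 2^-1 ^+ n.+1.

Let tol_gt0 n : 0 < tol n. Proof. by rewrite exprn_gt0 ?invr_gt0. Qed.

Let cvg_tol : tol @ \oo --> (0 : R).
Proof.
rewrite (cvg_shiftS (fun n => 2^-1 ^+ n : R)); apply: cvg_expr.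
by rewrite ger0_norm ?invr_ge0// invf_lt1 ?ltr1n.
Qed.

Lemma exists_cvg_minimizing_sequence : exists (u : nat -> T -> R) (q : T -> R),
  [/\ forall n, K (u n),
      forall n, Lnorm2 mu (u n \- f) ^+ 2 <= dist2 + tol n ^+ 2,
      q \in Lfun mu 2%:E &
      ('N[mu]_2%:E[EFin \o (u n \- q)%R] @[n --> \oo] --> 0)%E].
Proof.
have [u u_min] : {u : nat -> T -> R &
    forall n, K (u n) /\ Lnorm2 mu (u n \- f) ^+ 2 <= dist2 + tol n ^+ 2}.
  apply: (@choice _ _ (fun n p => K p /\ Lnorm2 mu (p \- f) ^+ 2 <= _)) => n.
  have [_ [p Kp <-] /ltW up] :=
    inf_adherent (exprn_gt0 2 (tol_gt0 n)) has_inf_dist2.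
  by exists p.
have Ku n : K (u n) by have [] := u_min n.
have u_incr n : Lnorm2 mu (u n.+1 \- u n) <= 2 * tol n.
  apply: dist_almost_minimizers_le (u_min n).2; rewrite ?(ltW (tol_gt0 n))//.
  rewrite (le_trans (u_min n.+1).2)// lerD2l.
  rewrite lerXn2r ?nnegrE ?(ltW (tol_gt0 _))//.
  by rewrite /tol [leLHS]exprS ger_pMl ?exprn_gt0 ?invr_gt0// invf_le1// ler1n.
have summable_u : (\sum_(n <oo) 'N[mu]_2%:E[EFin \o (u n.+1 \- u n)%R] < +oo)%E.
  apply: (@le_lt_trans _ _ 2%:E); last exact: ltry.
  apply: le_trans (epsilon_trick0 xpredT (ler0n R 2)).
  apply: lee_nneseries => [n _ _|n _]; first exact: Lnorm_ge0.
  rewrite -EFin_Lnorm2 ?lee_fin ?natrX -?exprVn ?u_incr//.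
  by apply: LfunB; rewrite ?lee1n//; exact: KL.
have [q Lq uq] := Lfun_complete (ler1n R 2) (fun n => KL (Ku n)) summable_u.
by exists u, q; split=> // n; exact: (u_min n).2.
Qed.

Theorem Lfun2_projection :
  exists2 q, K q & forall p, K p -> Lnorm2 mu (q \- f) <= Lnorm2 mu (p \- f).
Proof.
have [u [q [Ku u_min Lq uq]]] := exists_cvg_minimizing_sequence.
exists q => [|p Kp]; first exact: K_closed uq.
have up n : Lnorm2 mu (u n \- f) <= Lnorm2 mu (p \- f) + tol n.
  rewrite -(@ler_pXn2r _ 2) ?nnegrE ?addr_ge0 ?Lnorm2_ge0 ?(ltW (tol_gt0 n))//.
  rewrite (le_trans (u_min n))// sqrrD -addrA lerD ?dist2_le// lerDr.
  by rewrite mulrn_wge0// mulr_ge0 ?Lnorm2_ge0// ltW.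
have qp n : Lnorm2 mu (q \- f) <=
    Lnorm2 mu (p \- f) + (tol n + Lnorm2 mu (u n \- q)).
  rewrite (le_trans (Lnorm2_triangle Lq (KL (Ku n)) Lf))//.
  by rewrite addrC addrA lerD// /Lnorm2 Lnorm_distC.
have /cvgr_to_ge :
    Lnorm2 mu (p \- f) + (tol n + Lnorm2 mu (u n \- q)) @[n --> \oo]
      --> Lnorm2 mu (p \- f) + (0 + 0).
  by apply: cvgD; [exact: cvg_cst|apply: cvgD => //; exact: fine_cvg uq].
by rewrite !addr0; apply; exact: nearW.
Qed.

End Lfun2_projection.

Section restrict.
Context (T : Type) (R : realType).
Implicit Types (f g : T -> R) (D : set T).

Lemma restrict_out f D x : ~ D x -> (f \_ D) x = 0.
Proof. by move=> Dx; rewrite patchE memNset. Qed.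

Lemma restrict_supported f D : (forall x, ~ D x -> f x = 0) -> f \_ D = f.
Proof.
move=> f0; apply/funext => x; rewrite patchE.
by case: ifPn => // /negP xD; rewrite f0// => /mem_set.
Qed.

Lemma restrictK f D : (f \_ D) \_ D = f \_ D.
Proof. by rewrite -patch_setI setIid. Qed.

Lemma restrictB f g D : (f \- g) \_ D = f \_ D \- g \_ D.
Proof.
by apply/funext => x; rewrite /= !patchE; case: ifP; rewrite ?subr0.
Qed.

Lemma restrict_midpoint f g D :
  (2^-1 \*: (f \+ g)) \_ D = 2^-1 \*: (f \_ D \+ g \_ D).
Proof.
apply/funext => x; rewrite /= !patchE; case: ifP => // _.
by rewrite addr0 scaler0.
Qed.

Lemma ler_norm_restrict f D x : `|(f \_ D) x| <= `|f x|.
Proof. by rewrite patchE; case: ifP => // _; rewrite normr0. Qed.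

End restrict.

Section Lfun_estimates.
Context (d : measure_display) (T : measurableType d) (R : realType).
Variable mu : {measure set T -> \bar R}.
Implicit Types (f g : T -> R) (D : set T).
Local Notation "''N_' p [ f ]" := ('N[mu]_p[EFin \o f%R])%E.

Lemma Lnorm_indic (p : R) D : p != 0 -> measurable D ->
  ('N_p%:E[\1_D] = mu D `^ p^-1)%E.
Proof.
move=> p0 mD; rewrite unlock -[in RHS](setIT D).
rewrite -(integral_indic mu measurableT mD).
congr (_ `^ _)%E; apply: eq_integral => x _; rewrite /= indicE.
by case: (x \in D); rewrite ?normr1 ?powR1// normr0 powR0.
Qed.

(* Cauchy-Schwarz for [f] and [\1_D] *)
Lemma Lnorm1_restrict_le f D : measurable D -> measurable_fun setT f ->
  ('N_1[f \_ D] <= 'N_2%:E[f] * mu D `^ 2^-1)%E.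
Proof.
move=> mD mf; have m1D : measurable_fun setT (\1_D : T -> R).
  exact: measurable_indic.
rewrite patch_indic -Lnorm_indic// hoelder//.
by rewrite -div1r -splitr.
Qed.

Lemma measurable_fun_restrict f D : measurable D -> measurable_fun setT f ->
  measurable_fun setT (f \_ D).
Proof.
by move=> mD mf; apply/(measurable_restrictT f mD); exact: measurable_funS mf.
Qed.

Lemma Lnorm_restrict_le (p : R) f D : 1 <= p -> measurable D ->
  measurable_fun setT f -> ('N_p%:E[f \_ D] <= 'N_p%:E[f])%E.
Proof.
move=> p1 mD mf; apply: le_Lnorm => // [|x]; last exact: ler_norm_restrict.
exact: measurable_fun_restrict.
Qed.

Lemma Lfun_restrict (p : R) f D : 1 <= p -> measurable D ->
  f \in Lfun mu p%:E -> f \_ D \in Lfun mu p%:E.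
Proof.
move=> p1 mD /[dup] Lf /Lfun_measurable mf; apply: le_Lfun Lf => // [|x].
  exact: measurable_fun_restrict.
exact: ler_norm_restrict.
Qed.

Lemma Lfun2_restrict_Lfun1 f D : measurable D -> (mu D < +oo)%E ->
  f \in Lfun mu 2%:E -> f \_ D \in Lfun mu 1.
Proof.
move=> mD finD /Lfun_LnormP[mf finf]; apply/Lfun_LnormP; split.
  exact: measurable_fun_restrict.
rewrite (le_lt_trans (Lnorm1_restrict_le mD mf))//.
by rewrite lte_mul_pinfty ?Lnorm_ge0 ?ge0_fin_numE ?Lnorm_ge0 ?poweR_lty.
Qed.

Lemma ae_ge0_restrictP f D : {ae mu, forall x, 0 <= (f \_ D) x} <->
  {ae mu, forall x, D x -> 0 <= f x}.
Proof.
split; apply: filterS => x; rewrite patchE.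
  by move=> + Dx; rewrite mem_set.
by case: ifPn => // /set_mem Dx /(_ Dx).
Qed.

Lemma ae_eq_Rintegral f g : measurable_fun setT f -> measurable_fun setT g ->
  f = g %[ae mu] -> \int[mu]_x f x = \int[mu]_x g x.
Proof.
move=> mf mg fg; congr fine; apply: ae_eq_integral => //.
- exact/measurable_EFinP.
- exact/measurable_EFinP.
- by apply: filterS fg => x /(_ I) ->.
Qed.

Lemma exists_ge0_representative f D : L2 mu D f ->
  {ae mu, forall x, D x -> 0 <= f x} ->
  exists h : T -> R, [/\ h \in Lfun mu 2%:E, forall x, 0 <= h x, h \_ D = h,
    h = f \_ D %[ae mu] & \int[mu]_x h x = \int[mu]_(x in D) f x].
Proof.
rewrite /L2 => Lf /ae_ge0_restrictP/ae_ge0P/ae_eq_sym hf.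
have mf := Lfun_measurable Lf.
have mh : measurable_fun setT (Num.norm \o f \_ D) by exact: measurableT_comp.
exists (Num.norm \o f \_ D); split=> [|x||//|]; [|exact: normr_ge0|..].
- by apply: ae_eq_Lfun Lf; rewrite ?ler1n//; exact: ae_eq_sym.
- by rewrite -restrict_normr restrictK.
- by rewrite (ae_eq_Rintegral mh mf hf) -Rintegral_mkcond.
Qed.

(* If the integral vanishes then the scalar is [0], but so is [f] almost
   everywhere. *)
Lemma ae_eq_normalize f : f \in Lfun mu 1 -> (forall x, 0 <= f x) ->
  (fun x => f x * ((\int[mu]_y f y)^-1 * \int[mu]_y f y)) = f %[ae mu].
Proof.
move=> Lf f0; have [int0|int_neq0] := eqVneq (\int[mu]_y f y) 0; last first.
  by apply: aeW => x _; rewrite mulVf// mulr1.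
have /(Lnorm_eq0P _ (lexx 1) (Lfun_measurable Lf)) : ('N_1[f] = 0)%E.
  rewrite Lnorm1; under eq_integral do rewrite /= ger0_norm//.
  rewrite -[LHS]fineK; first by rewrite -/(Rintegral _ _ _) int0.
  by apply: integrable_fin_num => //; exact/Lfun1_integrable.
by apply: filterS => x /(_ I) ->; rewrite mul0r.
Qed.

End Lfun_estimates.

Definition transpose (T1 T2 V : Type) (f : T1 * T2 -> V) : T2 * T1 -> V :=
  fun z => f (z.2, z.1).

Lemma transpose_restrict (T1 T2 : Type) (V : pointedType) (D1 : set T1)
    (D2 : set T2) (f : T1 * T2 -> V) :
  transpose (f \_ (D1 `*` D2)) = transpose f \_ (D2 `*` D1).
Proof. by apply/funext => z; rewrite /transpose !patchE !in_setX andbC. Qed.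

Section transpose.
Context (d1 d2 : measure_display) (T1 : measurableType d1)
  (T2 : measurableType d2) (R : realType).
Variables (m1 : {sigma_finite_measure set T1 -> \bar R})
  (m2 : {sigma_finite_measure set T2 -> \bar R}).
Local Open Scope ereal_scope.

Lemma measurable_transpose d (V : measurableType d) (f : T1 * T2 -> V) :
  measurable_fun setT f -> measurable_fun setT (transpose f).
Proof.
by move=> mf; apply: (measurableT_comp mf); exact: measurable_fun_pair.
Qed.

Lemma ge0_integral_transpose (f : T1 * T2 -> \bar R) :
  measurable_fun setT f -> (forall z, 0 <= f z) ->
  \int[m2 \x m1]_z transpose f z = \int[m1 \x m2]_z f z.
Proof.
move=> mf f0; rewrite (fubini_tonelli1 (transpose f)).
- by rewrite fubini_tonelli2.
- exact: measurable_transpose.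
- by move=> z; exact: f0.
Qed.

Lemma Lnorm_transpose (p : R) (f : T1 * T2 -> R) : measurable_fun setT f ->
  'N[m2 \x m1]_p%:E[EFin \o transpose f] = 'N[m1 \x m2]_p%:E[EFin \o f].
Proof.
move=> mf; rewrite unlock; congr (_ `^ _).
apply: (@ge0_integral_transpose (fun z => `|(f z)%:E| `^ p)) => [|z].
  exact: measurable_norm_powR.
exact: poweR_ge0.
Qed.

Lemma Lfun_transpose (p : R) (f : T1 * T2 -> R) :
  f \in Lfun (m1 \x m2) p%:E -> transpose f \in Lfun (m2 \x m1) p%:E.
Proof.
move=> /Lfun_LnormP[mf finf]; apply/Lfun_LnormP.
by split; [exact: measurable_transpose|rewrite Lnorm_transpose].
Qed.

Lemma integral_transpose (f : T1 * T2 -> R) : f \in Lfun (m1 \x m2) 1 ->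
  \int[m2 \x m1]_z (transpose f z)%:E = \int[m1 \x m2]_z (f z)%:E.
Proof.
move=> Lf; have /Lfun1_integrable itf := Lfun_transpose Lf.
move/Lfun1_integrable: Lf => intf.
by rewrite -(integral12_prod_meas1 itf) -(integral21_prod_meas1 intf).
Qed.

Lemma ae_transpose (P : T1 * T2 -> Prop) :
  {ae m1 \x m2, forall z, P z} -> {ae m2 \x m1, forall z, transpose P z}.
Proof.
move=> [A [mA A0 PA]]; have mA' : measurable (transpose A).
  by rewrite -[transpose A]setTI; apply: measurable_fun_pair.
exists (transpose A); split=> [//||z]; last exact: PA.
rewrite -[transpose A]setIT -(integral_indic (m2 \x m1) measurableT mA').
transitivity (\int[m1 \x m2]_z (\1_A z)%:E).
  apply: (@ge0_integral_transpose (fun z => (\1_A z)%:E)) => [|z].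
    by apply/measurable_EFinP; exact: measurable_indic.
  by rewrite lee_fin.
by rewrite integral_indic// setIT.
Qed.

End transpose.

Definition marginal (T1 : Type) (d2 : measure_display) (T2 : measurableType d2)
    (R : realType) (m2 : {measure set T2 -> \bar R}) (p : T1 * T2 -> R)
    (x : T1) : R :=
  \int[m2]_y p (x, y).

Section marginal.
Context (d1 d2 : measure_display) (T1 : measurableType d1)
  (T2 : measurableType d2) (R : realType).
Variables (m1 : {sigma_finite_measure set T1 -> \bar R})
  (m2 : {sigma_finite_measure set T2 -> \bar R}).
Local Notation L1 := (Lfun (m1 \x m2)%E 1).
Implicit Types p q : T1 * T2 -> R.

Lemma ae_integrable_section p : p \in L1 ->
  {ae m1, forall x, m2.-integrable setT (fun y => (p (x, y))%:E)}.
Proof. by move=> /Lfun1_integrable; exact: ae_integrable1. Qed.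

Lemma ae_EFin_marginal p : p \in L1 ->
  {ae m1, forall x, (marginal m2 p x)%:E = (\int[m2]_y (p (x, y))%:E)%E}.
Proof.
move=> /ae_integrable_section; apply: filterS => x ip.
by rewrite fineK//; exact: integrable_fin_num.
Qed.

Lemma measurable_marginal p : p \in L1 -> measurable_fun setT (marginal m2 p).
Proof.
move=> /Lfun1_integrable ip.
by apply: measurableT_comp => //; exact: measurable_fubini_F ip.
Qed.

Lemma integral_marginal p : p \in L1 ->
  (\int[m1]_x (marginal m2 p x)%:E = \int[m1 \x m2]_z (p z)%:E)%E.
Proof.
move=> Lp; have ip := (Lfun1_integrable _ _).1 Lp.
rewrite -(integral12_prod_meas1 ip); apply: ae_eq_integral => //.
- exact/measurable_EFinP/measurable_marginal.
- exact: measurable_fubini_F ip.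
- by apply: filterS (ae_EFin_marginal Lp) => x ->.
Qed.

Lemma marginalB p q : p \in L1 -> q \in L1 ->
  marginal m2 (p \- q) = marginal m2 p \- marginal m2 q %[ae m1].
Proof.
move=> /ae_integrable_section + /ae_integrable_section.
by apply: filterS2 => x ip iq _; exact: RintegralB.
Qed.

Lemma marginal_midpoint p q (f : T1 -> R) : p \in L1 -> q \in L1 ->
  marginal m2 p = f %[ae m1] -> marginal m2 q = f %[ae m1] ->
  marginal m2 (2^-1 \*: (p \+ q)) = f %[ae m1].
Proof.
move=> /ae_integrable_section p_int /ae_integrable_section q_int pf qf.
apply: filterS3 p_int q_int (filterI pf qf) => x ip iq.
move=> [/(_ I) pfx /(_ I) qfx] _.
have ipq := integrableD measurableT ip iq.
have -> : marginal m2 (2^-1 \*: (p \+ q)) x =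
    2^-1 * (marginal m2 p x + marginal m2 q x).
  by rewrite -RintegralD// -RintegralZl.
by rewrite pfx qfx; field.
Qed.

Lemma Lnorm1_marginal_le p : p \in L1 ->
  ('N[m1]_1[EFin \o marginal m2 p] <= 'N[m1 \x m2]_1[EFin \o p])%E.
Proof.
move=> Lp; have mp := Lfun_measurable Lp.
have mEp : measurable_fun setT (fun z => `|(p z)%:E|)%E.
  by apply: measurableT_comp => //; exact/measurable_EFinP.
rewrite !Lnorm1 [leRHS]fubini_tonelli1//.
apply: ae_ge0_le_integral => //.
- by apply: measurableT_comp => //; exact/measurable_EFinP/measurable_marginal.
- by move=> x _; exact: integral_ge0.
- exact: measurable_fun_fubini_tonelli_F.
apply: filterS (ae_EFin_marginal Lp) => x px _.
rewrite [X in (abse X <= _)%E]px; apply: le_abse_integral => //.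
by apply/measurable_EFinP; exact: measurableT_comp.
Qed.

Lemma Lfun_marginal p : p \in L1 -> marginal m2 p \in Lfun m1 1.
Proof.
move=> Lp; have [_ finp] := (Lfun_LnormP _ _ _).1 Lp.
apply/Lfun_LnormP; split; first exact: measurable_marginal.
exact: le_lt_trans (Lnorm1_marginal_le Lp) finp.
Qed.

Lemma Lnorm1_marginalB_le p q : p \in L1 -> q \in L1 ->
  ('N[m1]_1[EFin \o (marginal m2 p \- marginal m2 q)%R] <=
    'N[m1 \x m2]_1[EFin \o (p \- q)%R])%E.
Proof.
move=> Lp Lq; have Lpq := LfunB (lexx _) Lp Lq.
rewrite -(ae_eq_Lnorm 1 _ _ (marginalB Lp Lq)).
- exact: Lnorm1_marginal_le.
- exact: measurable_marginal.
- by apply: measurable_funB; exact: measurable_marginal.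
Qed.

Lemma ae_eq_marginal p q : p \in L1 -> q \in L1 ->
  p = q %[ae (m1 \x m2)%E] -> marginal m2 p = marginal m2 q %[ae m1].
Proof.
move=> Lp Lq /(LnormB_eq0P (lexx 1) Lp Lq) dist0.
apply/(LnormB_eq0P (lexx 1) (Lfun_marginal Lp) (Lfun_marginal Lq)).
by apply/eqP; rewrite eq_le Lnorm_ge0 -dist0 Lnorm1_marginalB_le.
Qed.

Lemma marginal_Lnorm1_lim (u : nat -> T1 * T2 -> R) p (f : T1 -> R) :
  (forall n, u n \in L1) -> p \in L1 ->
  (forall n, marginal m2 (u n) = f %[ae m1]) ->
  ('N[m1 \x m2]_1[EFin \o (u n \- p)%R] @[n --> \oo] --> 0)%E ->
  marginal m2 p = f %[ae m1].
Proof.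
move=> Lu Lp uf up; have Lmu n := Lfun_marginal (Lu n).
apply: (ae_eq_Lnorm_lim (lexx 1) Lmu (Lfun_marginal Lp)) uf _.
apply: (squeeze_cvge _ (cvg_cst 0%E) up); apply: nearW => n.
by rewrite Lnorm_ge0 Lnorm1_marginalB_le.
Qed.

Lemma marginal_ge0 p : p \in L1 -> {ae (m1 \x m2)%E, forall z, 0 <= p z} ->
  {ae m1, forall x, 0 <= marginal m2 p x}.
Proof.
move=> Lp /ae_ge0P /(ae_eq_marginal Lp (Lfun_norm Lp)).
by apply: filterS => x /(_ I) ->; apply: Rintegral_ge0 => y _; exact: normr_ge0.
Qed.

Lemma integral_section_restrict (D1 : set T1) (D2 : set T2) p x :
  (\int[m2]_y ((p \_ (D1 `*` D2)) (x, y))%:E =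
    ((fun x => \int[m2]_(y in D2) (p (x, y))%:E) \_ D1) x)%E.
Proof.
rewrite patchE; case: ifPn => xD1.
  rewrite [RHS]integral_mkcond; apply: eq_integral => y _.
  by rewrite !patchE in_setX xD1/=; case: ifP.
by apply: integral0_eq => y _; rewrite patchE in_setX (negbTE xD1).
Qed.

Lemma marginal_restrictP (D1 : set T1) (D2 : set T2) p (f : T1 -> R) :
  p \_ (D1 `*` D2) \in L1 ->
  marginal m2 (p \_ (D1 `*` D2)) = f \_ D1 %[ae m1] <->
  {ae m1, forall x, D1 x -> (\int[m2]_(y in D2) (p (x, y))%:E = (f x)%:E)%E}.
Proof.
move=> /ae_EFin_marginal pE; split; apply: filterS2 pE => x;
  rewrite integral_section_restrict !patchE.
  by move=> + + D1x => /[swap] /(_ I) ->; rewrite !mem_set.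
by case: ifPn => [/set_mem D1x px /(_ D1x) fx|_ px _] _;
  apply: EFin_inj; rewrite px ?fx.
Qed.

Lemma sqr_norm_marginal_le (D2 : set T2) p (x : T1) : measurable D2 ->
  measurable_fun setT p -> (forall x y, ~ D2 y -> p (x, y) = 0) ->
  m2.-integrable setT (fun y => (p (x, y))%:E) ->
  ((`|marginal m2 p x| `^ 2)%:E <= m2 D2 * \int[m2]_y (`|p (x, y)| `^ 2)%:E)%E.
Proof.
move=> mD2 mp p0 ip.
have mpx : measurable_fun setT (fun y => p (x, y)) by exact: measurableT_comp.
have pE : (fun y => p (x, y)) \_ D2 = fun y => p (x, y).
  by apply: restrict_supported => y; exact: p0.
have le_norm : (`|(marginal m2 p x)%:E| <=
    'N[m2]_2%:E[EFin \o (fun y => p (x, y))] * m2 D2 `^ 2^-1)%E.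
  rewrite (le_trans _ (Lnorm1_restrict_le m2 mD2 mpx))// pE Lnorm1 fineK.
    by apply: le_abse_integral => //; exact/measurable_EFinP.
  exact: integrable_fin_num.
rewrite -[leLHS]/(`|(marginal m2 p x)%:E| `^ 2)%E.
rewrite (le_trans (lee_poweR (ler0n R 2) (abse_ge0 _) le_norm))//.
rewrite poweRM ?Lnorm_ge0 ?poweR_ge0// poweR_Lnorm// -poweRrM mulVf// poweRe1//.
by rewrite muleC.
Qed.

Lemma Lfun2_marginal (D2 : set T2) p : measurable D2 -> (m2 D2 < +oo)%E ->
  p \in L1 -> p \in Lfun (m1 \x m2)%E 2%:E ->
  (forall x y, ~ D2 y -> p (x, y) = 0) ->
  marginal m2 p \in Lfun m1 2%:E.
Proof.
move=> mD2 finD2 Lp L2p p0; have mp := Lfun_measurable Lp.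
have [_ intp2] := (Lfun_integralP _ (ler1n R 2) _).1 L2p.
apply/(Lfun_integralP _ (ler1n R 2) _); split; first exact: measurable_marginal.
have mp2 : measurable_fun setT (fun z => (`|p z| `^ 2)%:E).
  exact: measurable_norm_powR.
have p2_ge0 z : (0 <= (`|p z| `^ 2)%:E)%E by rewrite lee_fin powR_ge0.
apply: (@le_lt_trans _ _
  (\int[m1]_x (m2 D2 * \int[m2]_y (`|p (x, y)| `^ 2)%:E))%E).
  apply: ae_ge0_le_integral => //.
  - exact/measurable_norm_powR/measurable_marginal.
  - by move=> x _; rewrite mule_ge0// integral_ge0.
  - apply: emeasurable_funM => //.
    exact: measurable_fun_fubini_tonelli_F mp2 _.
  - apply: filterS (ae_integrable_section Lp) => x ip _.
    exact: sqr_norm_marginal_le.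
rewrite ge0_integralZl//; last 2 first.
- exact: measurable_fun_fubini_tonelli_F mp2 _.
- by move=> x _; exact: integral_ge0.
by rewrite lte_mul_pinfty// ?ge0_fin_numE// -(fubini_tonelli1 _ mp2).
Qed.

End marginal.

Definition tensor (T1 T2 : Type) (R : realType) (f : T1 -> R) (g : T2 -> R) :
    T1 * T2 -> R :=
  fun z => f z.1 * g z.2.

Lemma transpose_tensor (T1 T2 : Type) (R : realType) (f : T1 -> R)
    (g : T2 -> R) :
  transpose (tensor f g) = tensor g f.
Proof. by apply/funext => z; rewrite /transpose /tensor mulrC. Qed.

Section tensor.
Context (d1 d2 : measure_display) (T1 : measurableType d1)
  (T2 : measurableType d2) (R : realType).
Variables (m1 : {sigma_finite_measure set T1 -> \bar R})
  (m2 : {sigma_finite_measure set T2 -> \bar R}).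
Implicit Types (f : T1 -> R) (g : T2 -> R).

Lemma integral_tensor (F : T1 -> \bar R) (G : T2 -> \bar R) :
  measurable_fun setT F -> measurable_fun setT G ->
  (forall x, 0 <= F x)%E -> (forall y, 0 <= G y)%E ->
  (\int[m1 \x m2]_z (F z.1 * G z.2) = \int[m1]_x F x * \int[m2]_y G y)%E.
Proof.
move=> mF mG F0 G0; rewrite fubini_tonelli1.
- rewrite -ge0_integralZr ?integral_ge0//.
  by apply: eq_integral => x _; rewrite -ge0_integralZl.
- by apply: emeasurable_funM; exact: measurableT_comp.
- by move=> z; rewrite mule_ge0.
Qed.

Lemma Lfun_tensor (p : R) f g : 1 <= p -> f \in Lfun m1 p%:E ->
  g \in Lfun m2 p%:E -> tensor f g \in Lfun (m1 \x m2)%E p%:E.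
Proof.
move=> p1 /(Lfun_integralP _ p1)[mf finf] /(Lfun_integralP _ p1)[mg fing].
apply/(Lfun_integralP _ p1); split.
  by apply: measurable_funM; exact: measurableT_comp.
under eq_integral do rewrite normrM powRM// EFinM.
have mpowf := @measurable_norm_powR _ _ _ p _ mf.
have mpowg := @measurable_norm_powR _ _ _ p _ mg.
rewrite (integral_tensor mpowf mpowg) => [|x|y]; rewrite ?lee_fin ?powR_ge0//.
by rewrite lte_mul_pinfty ?ge0_fin_numE// integral_ge0// => x _;
  rewrite lee_fin powR_ge0.
Qed.

Lemma marginal_tensor f g : g \in Lfun m2 1 ->
  marginal m2 (tensor f g) = fun x => f x * \int[m2]_y g y.
Proof.
by move=> /Lfun1_integrable ig; apply/funext => x; rewrite -RintegralZl.
Qed.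

End tensor.

Section coupling.
Context (d1 d2 : measure_display) (T1 : measurableType d1)
  (T2 : measurableType d2) (R : realType).
Variables (m1 : {sigma_finite_measure set T1 -> \bar R})
  (m2 : {sigma_finite_measure set T2 -> \bar R}).
Implicit Types (f : T1 -> R) (g : T2 -> R) (p : T1 * T2 -> R).

Definition coupling f g p : Prop :=
  [/\ p \in Lfun (m1 \x m2)%E 1, marginal m2 p = f %[ae m1],
      marginal m1 (transpose p) = g %[ae m2] &
      {ae (m1 \x m2)%E, forall z, 0 <= p z}].

Lemma coupling_midpoint f g : midpoint_closed (coupling f g).
Proof.
move=> p q [Lp pf pg p0] [Lq qf qg q0].
split; first by apply/LfunZ/LfunD.
- exact: marginal_midpoint.
- exact: (marginal_midpoint (Lfun_transpose Lp) (Lfun_transpose Lq)).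
- by apply: filterS2 p0 q0 => z pz qz; rewrite mulr_ge0// addr_ge0.
Qed.

Lemma coupling_Lnorm1_closed f g : Lnorm_closed (m1 \x m2)%E 1 (coupling f g).
Proof.
move=> u p cu Lp up.
have Lu n : u n \in Lfun (m1 \x m2)%E 1 by have [] := cu n.
split=> //.
- by apply: marginal_Lnorm1_lim up => // n; have [] := cu n.
- have distE n : ('N[m2 \x m1]_1[EFin \o (transpose (u n) \- transpose p)%R] =
      'N[m1 \x m2]_1[EFin \o (u n \- p)%R])%E.
    apply: (Lnorm_transpose m1 m2 1 (f := u n \- p)).
    exact: Lfun_measurable (LfunB (lexx _) (Lu n) Lp).
  move: (up); rewrite -(funext distE) => up'.
  apply: marginal_Lnorm1_lim up' => [n||n]; rewrite ?Lfun_transpose//.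
  by have [] := cu n.
- by apply: (ae_ge0_Lnorm_lim (lexx 1)) up => // n; have [] := cu n.
Qed.

Lemma coupling_fst_ge0 f g p : coupling f g p -> {ae m1, forall x, 0 <= f x}.
Proof.
move=> [Lp pf _ p0]; apply: filterS2 pf (marginal_ge0 Lp p0) => x.
by move=> /(_ I) <-.
Qed.

Lemma coupling_fst_integral f g p : measurable_fun setT f -> coupling f g p ->
  (\int[m1]_x (f x)%:E = \int[m1 \x m2]_z (p z)%:E)%E.
Proof.
move=> mf [Lp pf _ _]; rewrite -integral_marginal//.
apply: ae_eq_integral => //; first exact/measurable_EFinP.
  exact/measurable_EFinP/(measurable_marginal Lp).
by apply: filterS pf => x /(_ I) /= ->.
Qed.

Lemma coupling_fst_Lfun2 (D2 : set T2) f g p :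
  measurable D2 -> (m2 D2 < +oo)%E ->
  (forall x y, ~ D2 y -> p (x, y) = 0) -> measurable_fun setT f ->
  p \in Lfun (m1 \x m2)%E 2%:E -> coupling f g p -> f \in Lfun m1 2%:E.
Proof.
move=> mD2 finD2 p0 mf L2p [Lp pf _ _].
by apply: ae_eq_Lfun pf _; rewrite ?ler1n//; exact: Lfun2_marginal p0.
Qed.

Lemma ae_eq_coupling f f' g g' p : f = f' %[ae m1] -> g = g' %[ae m2] ->
  coupling f g p -> coupling f' g' p.
Proof.
by move=> ff' gg' [Lp pf pg p0]; split=> //;
  [exact: ae_eq_trans pf ff'|exact: ae_eq_trans pg gg'].
Qed.

Lemma coupling_tensor f g : f \in Lfun m1 1 -> g \in Lfun m2 1 ->
  (forall x, 0 <= f x) -> (forall y, 0 <= g y) ->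
  \int[m1]_x f x = \int[m2]_y g y ->
  coupling f g (tensor ((\int[m1]_x f x)^-1 \*: f) g).
Proof.
move=> Lf Lg f0 g0 fg; set M := \int[m1]_x f x.
have LMf : M^-1 \*: f \in Lfun m1 1 by exact: LfunZ.
have intMf : \int[m1]_x (M^-1 * f x) = M^-1 * M.
  by rewrite RintegralZl//; exact/Lfun1_integrable.
split; first exact: Lfun_tensor.
- rewrite marginal_tensor// -fg; apply: filterS (ae_eq_normalize Lf f0) => x.
  move=> /(_ I) fx _; have -> : (M^-1 \*: f) x = f x * M^-1 by exact: mulrC.
  by rewrite -mulrA.
- rewrite transpose_tensor marginal_tensor// intMf /M fg.
  exact: ae_eq_normalize.
- apply: aeW => z; rewrite /tensor !mulr_ge0// invr_ge0.
  by apply: Rintegral_ge0 => x _; exact: f0.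
Qed.

End coupling.

Lemma coupling_transpose (d1 d2 : measure_display) (T1 : measurableType d1)
    (T2 : measurableType d2) (R : realType)
    (m1 : {sigma_finite_measure set T1 -> \bar R})
    (m2 : {sigma_finite_measure set T2 -> \bar R})
    (f : T1 -> R) (g : T2 -> R) (p : T1 * T2 -> R) :
  coupling m1 m2 f g p -> coupling m2 m1 g f (transpose p).
Proof.
move=> [Lp pf pg p0]; split=> //; first exact: Lfun_transpose.
exact: ae_transpose p0.
Qed.

Lemma coupling_mass (d1 d2 : measure_display) (T1 : measurableType d1)
    (T2 : measurableType d2) (R : realType)
    (m1 : {sigma_finite_measure set T1 -> \bar R})
    (m2 : {sigma_finite_measure set T2 -> \bar R})
    (f : T1 -> R) (g : T2 -> R) (p : T1 * T2 -> R) :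
  measurable_fun setT f -> measurable_fun setT g -> coupling m1 m2 f g p ->
  (\int[m1]_x (f x)%:E = \int[m2]_y (g y)%:E)%E.
Proof.
move=> mf mg cp; have [Lp _ _ _] := cp.
rewrite (coupling_fst_integral mf cp) -integral_transpose//.
by rewrite (coupling_fst_integral mg (coupling_transpose cp)).
Qed.

Section coupling_on_product_domain.
Context (d1 d2 : measure_display) (T1 : measurableType d1)
  (T2 : measurableType d2) (R : realType).
Variables (m1 : {sigma_finite_measure set T1 -> \bar R})
  (m2 : {sigma_finite_measure set T2 -> \bar R}).
Variables (D1 : set T1) (D2 : set T2).
Hypotheses (mD1 : measurable D1) (mD2 : measurable D2).
Hypotheses (finD1 : (m1 D1 < +oo)%E) (finD2 : (m2 D2 < +oo)%E).
Variables (mu1 : T1 -> R) (mu2 : T2 -> R).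
Implicit Types f p q : T1 * T2 -> R.
Local Notation D := (D1 `*` D2).
Local Notation l := (m1 \x m2)%E.

Let mD : measurable D. Proof. exact: measurableX. Qed.

Let finD : (l D < +oo)%E.
Proof. by rewrite product_measure1E// lte_mul_pinfty// ge0_fin_numE. Qed.

(* Values outside of [D] are left free: vanishing there at every point would not
   be closed in L^2. *)
Definition Lfun2_coupling : set (T1 * T2 -> R) :=
  [set p | p \in Lfun l 2%:E /\
    coupling m1 m2 (mu1 \_ D1) (mu2 \_ D2) (p \_ D)].

Lemma Lfun2_coupling_restrict p : Lfun2_coupling p -> Lfun2_coupling (p \_ D).
Proof.
move=> [Lp cp]; split; last by rewrite restrictK.
by apply: Lfun_restrict; rewrite ?ler1n.
Qed.

Lemma Lfun2_coupling_restrictP p : Lfun2_coupling (p \_ D) <->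
  [/\ L2 l D p,
      {ae m1, forall x, D1 x ->
        (\int[m2]_(y in D2) (p (x, y))%:E = (mu1 x)%:E)%E},
      {ae m2, forall y, D2 y ->
        (\int[m1]_(x in D1) (p (x, y))%:E = (mu2 y)%:E)%E} &
      {ae l, forall z, D z -> 0 <= p z}].
Proof.
rewrite /Lfun2_coupling/= restrictK; split=> [[Lp []]|[Lp p1 p2 p_ge0]].
  move=> Lp1 p1 p2 p_ge0; split=> //.
  - exact/(marginal_restrictP _ Lp1).
  - move: p2; rewrite transpose_restrict => /marginal_restrictP; apply.
    by rewrite -transpose_restrict; exact: Lfun_transpose.
  - exact/ae_ge0_restrictP.
have Lp1 : p \_ D \in Lfun l 1.
  by rewrite -restrictK; exact: Lfun2_restrict_Lfun1.
split=> //; split=> //.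
- exact/marginal_restrictP.
- rewrite transpose_restrict; apply/marginal_restrictP => //.
  by rewrite -transpose_restrict; exact: Lfun_transpose.
- exact/ae_ge0_restrictP.
Qed.

Lemma Lfun2_coupling_midpoint : midpoint_closed Lfun2_coupling.
Proof.
move=> p q [Lp cp] [Lq cq]; split; first by apply/LfunZ/LfunD; rewrite ?lee1n.
rewrite restrict_midpoint; exact: coupling_midpoint.
Qed.

Lemma Lfun2_coupling_closed : Lnorm_closed l 2%:E Lfun2_coupling.
Proof.
move=> u p cu Lp up; split=> //.
apply: (coupling_Lnorm1_closed (u := fun n => u n \_ D)) => [n||].
- by have [] := cu n.
- exact: Lfun2_restrict_Lfun1.
have Lup n : u n \- p \in Lfun l 2%:E.
  by rewrite LfunB ?lee1n//; have [] := cu n.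
apply: (squeeze_cvge _ (cvg_cst 0%E)); last first.
  rewrite -(mul0e (l D `^ 2^-1)%E); apply: cvgeZr up.
  by rewrite fin_num_poweR// ge0_fin_numE.
apply: nearW => n; rewrite Lnorm_ge0 -restrictB.
exact: Lnorm1_restrict_le (Lfun_measurable (Lup n)).
Qed.

Lemma Lfun2_coupling_projection f : f \in Lfun l 2%:E -> f \_ D = f ->
  Lfun2_coupling !=set0 -> exists q, [/\ Lfun2_coupling q, q \_ D = q &
    forall p, Lfun2_coupling p -> Lnorm2 l (q \- f) <= Lnorm2 l (p \- f)].
Proof.
move=> Lf fD K0; have [|q cq q_min] := Lfun2_projection K0 _
  Lfun2_coupling_midpoint Lfun2_coupling_closed Lf; first by move=> p [].
exists (q \_ D); split=> [||p cp]; first exact: Lfun2_coupling_restrict.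
  exact: restrictK.
apply: le_trans (q_min p cp).
have Lqf : q \- f \in Lfun l 2%:E by rewrite LfunB ?lee1n//; have [] := cq.
rewrite -[in leLHS]fD -restrictB -lee_fin !EFin_Lnorm2 ?Lfun_restrict ?ler1n//.
exact: Lnorm_restrict_le (ler1n R 2) mD (Lfun_measurable Lqf).
Qed.

Lemma Lfun2_coupling_marginals p :
  measurable_fun D1 mu1 -> measurable_fun D2 mu2 -> Lfun2_coupling p ->
  [/\ L2 m1 D1 mu1, L2 m2 D2 mu2,
      {ae m1, forall x, D1 x -> 0 <= mu1 x},
      {ae m2, forall y, D2 y -> 0 <= mu2 y} &
      (\int[m1]_(x in D1) (mu1 x)%:E = \int[m2]_(y in D2) (mu2 y)%:E)%E].
Proof.
move=> /(measurable_restrictT mu1 mD1) mmu1.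
move=> /(measurable_restrictT mu2 mD2) mmu2.
move=> [/(Lfun_restrict (ler1n R 2) mD) Lp cp].
have [ctp Ltp] := (coupling_transpose cp, Lfun_transpose Lp).
split.
- apply: coupling_fst_Lfun2 finD2 _ mmu1 Lp cp => // x y D2y.
  by rewrite restrict_out// => -[].
- apply: coupling_fst_Lfun2 finD1 _ mmu2 Ltp ctp => // y x D1x.
  by rewrite /transpose restrict_out// => -[].
- exact/ae_ge0_restrictP/(coupling_fst_ge0 cp).
- exact/ae_ge0_restrictP/(coupling_fst_ge0 ctp).
- rewrite integral_mkcond [RHS]integral_mkcond !restrict_EFin.
  exact: coupling_mass mmu1 mmu2 cp.
Qed.

Lemma Lfun2_coupling_nonempty :
  L2 m1 D1 mu1 -> L2 m2 D2 mu2 ->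
  {ae m1, forall x, D1 x -> 0 <= mu1 x} ->
  {ae m2, forall y, D2 y -> 0 <= mu2 y} ->
  (\int[m1]_(x in D1) (mu1 x)%:E = \int[m2]_(y in D2) (mu2 y)%:E)%E ->
  Lfun2_coupling !=set0.
Proof.
move=> Lmu1 Lmu2 mu1_ge0 mu2_ge0 mass.
have [f [Lf f_ge0 fD fmu intf]] := exists_ge0_representative Lmu1 mu1_ge0.
have [g [Lg g_ge0 gD gmu intg]] := exists_ge0_representative Lmu2 mu2_ge0.
have L1f : f \in Lfun m1 1 by rewrite -fD; exact: Lfun2_restrict_Lfun1.
have L1g : g \in Lfun m2 1 by rewrite -gD; exact: Lfun2_restrict_Lfun1.
have fg : \int[m1]_x f x = \int[m2]_y g y by rewrite intf intg /Rintegral mass.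
exists (tensor ((\int[m1]_x f x)^-1 \*: f) g); split.
  by apply: Lfun_tensor; rewrite ?ler1n//; apply: LfunZ; rewrite ?lee1n.
rewrite [X in coupling _ _ _ _ X]restrict_supported => [|[x y]].
  exact: ae_eq_coupling fmu gmu (coupling_tensor L1f L1g f_ge0 g_ge0 fg).
rewrite /tensor/= -fD -gD => /not_andP[]/= Dxy.
  by rewrite (restrict_out f)// scaler0 mul0r.
by rewrite (restrict_out g)// mulr0.
Qed.

End coupling_on_product_domain.

Section regularized_transport.
Context (R : realType) (d1 d2 : nat).
Variables (Om1 : set 'rV[R]_d1) (Om2 : set 'rV[R]_d2).
Hypothesis mOm1 : measurable (Om1 : set (lebesgue_space R d1)).
Hypothesis mOm2 : measurable (Om2 : set (lebesgue_space R d2)).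
Hypothesis finOm1 : (lebesgue R d1 Om1 < +oo)%E.
Hypothesis finOm2 : (lebesgue R d2 Om2 < +oo)%E.
Variables (mu1 : 'rV[R]_d1 -> R) (mu2 : 'rV[R]_d2 -> R).
Local Notation Om := (Om1 `*` Om2).
Local Notation l1 := (lebesgue R d1).
Local Notation l2 := (lebesgue R d2).
Local Notation l := (l1 \x l2)%E.
Implicit Types p q : 'rV[R]_d1 * 'rV[R]_d2 -> R.

Local Notation couplings := (Lfun2_coupling l1 l2 Om1 Om2 mu1 mu2).

Lemma feasibleP p : feasible Om1 Om2 mu1 mu2 p <-> couplings (p \_ Om).
Proof.
exact: iff_sym (Lfun2_coupling_restrictP mOm1 mOm2 finOm1 finOm2 mu1 mu2 p).
Qed.

Section objective.
Variables (c : 'rV[R]_d1 * 'rV[R]_d2 -> R) (gamma : R).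
Hypotheses (Lc : L2 l Om c) (gamma_gt0 : 0 < gamma).

Let target : 'rV[R]_d1 * 'rV[R]_d2 -> R := - gamma^-1 \*: (c \_ Om).

Lemma objectiveE p : L2 l Om p -> objective Om1 Om2 c gamma p =
  gamma / 2 * Lnorm2 l (p \_ Om \- target) ^+ 2
    - gamma / 2 * Lnorm2 l target ^+ 2.
Proof.
move=> Lp; rewrite -complete_square ?gt_eqF//; congr (_ + _).
rewrite Rintegral_mkcond; apply: eq_Rintegral => z _.
by rewrite !patchE; case: ifP => //; rewrite mul0r.
Qed.

Lemma exists_optimal : couplings !=set0 ->
  exists p, optimal Om1 Om2 c gamma mu1 mu2 p.
Proof.
move=> couplings0.
have Ltarget : target \in Lfun l 2%:E by apply: LfunZ; rewrite ?lee1n.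
have targetOm : target \_ Om = target.
  apply: restrict_supported => z Omz; rewrite /target/= restrict_out//.
  exact: mulr0.
have [q [cq qOm q_min]] := Lfun2_coupling_projection mOm1 mOm2 finOm1 finOm2
  Ltarget targetOm couplings0.
exists q; have fq : feasible Om1 Om2 mu1 mu2 q by apply/feasibleP; rewrite qOm.
split=> // p /[dup] fp /feasibleP cp.
have [[Lq _ _ _] [Lp _ _ _]] := (fq, fp).
rewrite !objectiveE// lerD2r ler_pM2l ?divr_gt0// qOm.
by rewrite ler_pXn2r ?nnegrE ?Lnorm2_ge0 ?q_min.
Qed.

End objective.
End regularized_transport.

Theorem lemma2p1 (R : realType) (d1 d2 : nat)
    (Om1 : set 'rV[R]_d1) (Om2 : set 'rV[R]_d2)
    (hOm1 : compact_domain Om1) (hOm2 : compact_domain Om2)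
    (c : 'rV[R]_d1 * 'rV[R]_d2 -> R)
    (hc : L2 (lebesgue R d1 \x lebesgue R d2)%E (Om1 `*` Om2) c)
    (gamma : R) (hgamma : 0 < gamma)
    (mu1 : 'rV[R]_d1 -> R) (mu2 : 'rV[R]_d2 -> R)
    (hmu1 : @measurable_fun _ _ (lebesgue_space R d1) R Om1 mu1)
    (hmu2 : @measurable_fun _ _ (lebesgue_space R d2) R Om2 mu2) :
  (exists p, optimal Om1 Om2 c gamma mu1 mu2 p) <->
  [/\ L2 (lebesgue R d1) Om1 mu1, L2 (lebesgue R d2) Om2 mu2,
      {ae lebesgue R d1, forall x, Om1 x -> 0 <= mu1 x},
      {ae lebesgue R d2, forall x, Om2 x -> 0 <= mu2 x} &
      (\int[lebesgue R d1]_(x in Om1) (mu1 x)%:E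
        = \int[lebesgue R d2]_(x in Om2) (mu2 x)%:E)%E].
Proof.
have [[cpt1 _] [cpt2 _]] := (hOm1, hOm2).
have mOm1 := compact_lebesgue_measurable cpt1.
have mOm2 := compact_lebesgue_measurable cpt2.
have finOm1 := compact_lebesgue_lty cpt1.
have finOm2 := compact_lebesgue_lty cpt2.
split=> [[p [fp _]]|[Lmu1 Lmu2 mu1_ge0 mu2_ge0 mass]].
  move/(feasibleP mOm1 mOm2 finOm1 finOm2): fp => coupling_p.
  exact: Lfun2_coupling_marginals coupling_p.
by apply: exists_optimal => //; exact: Lfun2_coupling_nonempty.
Qed.
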